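(* The $(2,3)$-reducible nilpotent matrix $$\mathsf{N}=\begin{pmatrix}0&1&0&0&0\\0&0&0&0&0\\0&0&0&1&0\\0&0&0&0&1\\0&0&0&0&0\end{pmatrix}$$ has the following normal form: $$\begin{aligned}F(x)={}&\mathsf{N}x+\begin{pmatrix}0\\ x_1x_2F_{1,2}^0(x_1,x_2,x_3,x_4,x_5)\\0\\0\\ x_1x_2G_{1,2}^0(x_1,x_2,x_3,x_4,x_5)\end{pmatrix}+\begin{pmatrix}0\\ x_1x_5F_{1,5}^0(x_1,x_3,x_4,x_5)\\0\\0\\ x_1x_5G_{1,5}^0(x_1,x_3,x_4,x_5)\end{pmatrix}\\ &+\begin{pmatrix}0\\ x_2x_3F_{2,3}^0(x_2,x_3,x_4,x_5)\\0\\0\\ x_2x_3G_{2,3}^0(x_2,x_3,x_4,x_5)\end{pmatrix}+\begin{pmatrix}0\\ x_3x_5F_{3,5}^0(x_3,x_4,x_5)\\0\\0\\ x_3x_5G_{3,5}^0(x_3,x_4,x_5)\end{pmatrix}+\begin{pmatrix}0\\ x_1F_1^0(x_1,x_3,x_4)\\0\\0\\ x_1G_1^0(x_1,x_3,x_4)\end{pmatrix}\\ &+\begin{pmatrix}x_1F_1^1(x_1,x_3,x_4)\\ x_2F_1^1(x_2,x_4,x_5)\\0\\ \frac12x_1G_1^1(x_1,x_3,x_4)\\ x_2G_1^1(x_2,x_4,x_5)\end{pmatrix}+\begin{pmatrix}0\\ x_3x_4F_4^0(x_3,x_4)\\0\\0\\ x_3x_4G_4^0(x_3,x_4)\end{pmatrix}+\begin{pmatrix}x_3x_4F_4^1(x_3,x_4)\\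 \frac12x_4x_5F_4^1(x_4,x_5)\\0\\ \frac12x_3x_4G_4^1(x_3,x_4)\\ \frac12x_4x_5G_4^1(x_4,x_5)\end{pmatrix}\\ &+\begin{pmatrix}0\\ x_3F_3^0(x_3)\\0\\0\\ x_3G_3^0(x_3)\end{pmatrix}+\begin{pmatrix}\frac12x_3F_3^1(x_3)\\ x_4F_3^1(x_4)\\0\\ \frac12x_3G_3^1(x_3)\\ \frac12x_4G_3^1(x_4)\end{pmatrix}+\begin{pmatrix}0\\0\\ \frac12x_3G_3^2(x_3)\\ \frac12x_4G_3^2(x_4)\\ \frac12x_5G_3^2(x_5)\end{pmatrix},\end{aligned}$$ where the $F$'s and $G$'s are arbitrary formal power series in the indicated variables. That is, for every $k\ge1$, if $\mathcal{C}_k\subset\mathcal{P}^5_k$ denotes the set of homogeneous components of degree $k+1$ of all maps $F(x)-\mathsf{N}x$ obtained from this expression for $F(x)$ as $F_{1,2}^0,F_{1,5}^0,F_{2,3}^0,F_{3,5}^0,F_1^0,F_1^1,F_4^0,F_4^1,F_3^0,F_3^1$ and $G_{1,2}^0,G_{1,5}^0,G_{2,3}^0,G_{3,5}^0,G_1^0,G_1^1,G_4^0,G_4^1,G_3^0,G_3^1,G_3^2$ range over all formal power series in their indicated variables, then $\mathcal{P}^5_k=\operatorname{im}\left(\nabla_{\mathsf{N}}|_{\mathcal{P}^5_k}\right)\oplus\mathcal{C}_k$.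
   Context: $P_k$ is the space of real homogeneous polynomials of degree $k$ in $x_1,\dots,x_n$ and $\mathcal{P}^n_k=P_{k+1}\otimes\mathbb{R}^n$ (here $n=5$). For an $n\times n$ matrix $A$, the homological operator is $(\nabla_A\varphi)(x)=A\varphi(x)-\varphi(Ax)$; it preserves each $\mathcal{P}^n_k$. A map $f=Ax+\sum_{k\ge1}f_k$ with $f_k\in\mathcal{P}^n_k$ is said to be in normal form (with style $\mathcal{C}$) with respect to its linear part $A$ if $f_k\in\mathcal{C}_k$ for all $k\ge1$, where $\mathcal{P}^n_k=\operatorname{im}\nabla_A\oplus\mathcal{C}_k$. *)

(* Defs.v *)
From HB Require Import structures.
From mathcomp Require Import all_boot all_order all_algebra.
From mathcomp Require Import mpoly.
From mathcomp Require Import classical_sets functions reals.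

Set Implicit Arguments.
Unset Strict Implicit.
Unset Printing Implicit Defensive.

Import GRing.Theory.
Local Open Scope classical_set_scope.
Local Open Scope ring_scope.

Definition direct_sum (K : nzRingType) (V : lmodType K) (P U W : set V) : Prop :=
  [/\ GRing.submod_closed (mem U), GRing.submod_closed (mem W),
      [set u + w | u in U & w in W] = P & U `&` W = [set 0]].

(* P_{k+1} (x) R^n, as n-tuples of homogeneous polynomials of degree k+1. *)
Definition hpoly_map (R : realType) (n k : nat) : set ('I_n -> {mpoly R[n]}) :=
  [set phi | forall i, phi i \is k.+1.-homog].

Definition hom_op (R : realType) (n : nat) (A : 'M[R]_n)
    (phi : 'I_n -> {mpoly R[n]}) : 'I_n -> {mpoly R[n]} :=
  fun i => \sum_j A i j *: phi j
           - (phi i \mPo [tuple \sum_(s < n) A r s *: 'X_s | r < n]).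

(* A formal power series is given by its coefficients, so that addition and
   scaling are pointwise; the product is the Cauchy product fps_mul. *)
Definition fps (R : realType) (n : nat) : Type := 'X_{1..n} -> R^o.

HB.instance Definition _ (R : realType) (n : nat) :=
  GRing.Lmodule.copy (fps R n) ('X_{1..n} -> R^o).

Section FormalPowerSeries.
Variable R : realType.

Definition fps_var (n : nat) (i : 'I_n) : fps R n :=
  fun a => (a == U_(i)%MM)%:R.

Definition fps_mul (n : nat) (f g : fps R n) : fps R n := fun a =>
  \sum_(b : 'X_{1..n < (mdeg a).+1, (mdeg a).+1} | a == (b.1 + b.2)%MM)
     f b.1 * g b.2.

(* f(x_{t_1}, ..., x_{t_m}); only finitely many monomials of f contribute to
   each coefficient, because a monomial keeps its degree. *)
Definition fps_at (m n : nat) (f : fps R m) (t : m.-tuple 'I_n) : fps R n :=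
  fun a => \sum_(b : 'X_{1..m < (mdeg a).+1}
                   | (\sum_(i < m) U_(tnth t i) *+ b i)%MM == a) f b.

Definition fps_hcomp (n d : nat) (f : fps R n) : {mpoly R[n]} :=
  \sum_(a : 'X_{1..n < d.+1} | mdeg a == d) f a *: 'X_[a].

Definition fps_linear (n : nat) (A : 'M[R]_n) : 'I_n -> fps R n :=
  fun i => \sum_j A i j *: fps_var j.

End FormalPowerSeries.

Definition vec5 (T : Type) (a1 a2 a3 a4 a5 : T) : 'I_5 -> T :=
  tnth [tuple a1; a2; a3; a4; a5].

Definition N23 (R : realType) : 'M[R]_5 :=
  \matrix_(i < 5, j < 5)
    nth 0 (nth [::] [:: [:: 0; 1; 0; 0; 0];
                        [:: 0; 0; 0; 0; 0];
                        [:: 0; 0; 0; 1; 0];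
                        [:: 0; 0; 0; 0; 1];
                        [:: 0; 0; 0; 0; 0]] i) j.

(* Fij_l stands for F_{i,j}^l and Fi_l for F_i^l; likewise for G. *)
Record nf_series (R : realType) := NFSeries {
  F12_0 : fps R 5;  G12_0 : fps R 5;
  F15_0 : fps R 4;  G15_0 : fps R 4;
  F23_0 : fps R 4;  G23_0 : fps R 4;
  F35_0 : fps R 3;  G35_0 : fps R 3;
  F1_0 : fps R 3;   G1_0 : fps R 3;
  F1_1 : fps R 3;   G1_1 : fps R 3;
  F4_0 : fps R 2;   G4_0 : fps R 2;
  F4_1 : fps R 2;   G4_1 : fps R 2;
  F3_0 : fps R 1;   G3_0 : fps R 1;
  F3_1 : fps R 1;   G3_1 : fps R 1;
                    G3_2 : fps R 1 }.

Definition i1 : 'I_5 := @Ordinal 5 0 isT.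
Definition i2 : 'I_5 := @Ordinal 5 1 isT.
Definition i3 : 'I_5 := @Ordinal 5 2 isT.
Definition i4 : 'I_5 := @Ordinal 5 3 isT.
Definition i5 : 'I_5 := @Ordinal 5 4 isT.

Section NormalForm.
Variables (R : realType) (s : nf_series R).

(* Not "*": on fps R n, ring_scope would read it as the pointwise product. *)
Local Infix "**" := (@fps_mul R 5) (at level 40, left associativity).
Local Notation "f $ t" := (fps_at f t) (at level 30, no associativity).
Local Notation x1 := (fps_var R i1).
Local Notation x2 := (fps_var R i2).
Local Notation x3 := (fps_var R i3).
Local Notation x4 := (fps_var R i4).
Local Notation x5 := (fps_var R i5).
Local Notation half := (2^-1 : R).

Definition nf_map : 'I_5 -> fps R 5 :=
    fps_linear (N23 R)
  + vec5 0
         (x1 ** x2 ** F12_0 s $ [tuple i1; i2; i3; i4; i5])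
         0
         0
         (x1 ** x2 ** G12_0 s $ [tuple i1; i2; i3; i4; i5])
  + vec5 0
         (x1 ** x5 ** F15_0 s $ [tuple i1; i3; i4; i5])
         0
         0
         (x1 ** x5 ** G15_0 s $ [tuple i1; i3; i4; i5])
  + vec5 0
         (x2 ** x3 ** F23_0 s $ [tuple i2; i3; i4; i5])
         0
         0
         (x2 ** x3 ** G23_0 s $ [tuple i2; i3; i4; i5])
  + vec5 0
         (x3 ** x5 ** F35_0 s $ [tuple i3; i4; i5])
         0
         0
         (x3 ** x5 ** G35_0 s $ [tuple i3; i4; i5])
  + vec5 0
         (x1 ** F1_0 s $ [tuple i1; i3; i4])
         0
         0
         (x1 ** G1_0 s $ [tuple i1; i3; i4])
  + vec5 (x1 ** F1_1 s $ [tuple i1; i3; i4])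
         (x2 ** F1_1 s $ [tuple i2; i4; i5])
         0
         (half *: (x1 ** G1_1 s $ [tuple i1; i3; i4]))
         (x2 ** G1_1 s $ [tuple i2; i4; i5])
  + vec5 0
         (x3 ** x4 ** F4_0 s $ [tuple i3; i4])
         0
         0
         (x3 ** x4 ** G4_0 s $ [tuple i3; i4])
  + vec5 (x3 ** x4 ** F4_1 s $ [tuple i3; i4])
         (half *: (x4 ** x5 ** F4_1 s $ [tuple i4; i5]))
         0
         (half *: (x3 ** x4 ** G4_1 s $ [tuple i3; i4]))
         (half *: (x4 ** x5 ** G4_1 s $ [tuple i4; i5]))
  + vec5 0
         (x3 ** F3_0 s $ [tuple i3])
         0
         0
         (x3 ** G3_0 s $ [tuple i3])
  + vec5 (half *: (x3 ** F3_1 s $ [tuple i3]))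
         (x4 ** F3_1 s $ [tuple i4])
         0
         (half *: (x3 ** G3_1 s $ [tuple i3]))
         (half *: (x4 ** G3_1 s $ [tuple i4]))
  + vec5 0
         0
         (half *: (x3 ** G3_2 s $ [tuple i3]))
         (half *: (x4 ** G3_2 s $ [tuple i4]))
         (half *: (x5 ** G3_2 s $ [tuple i5])).

End NormalForm.

Definition nf_style (R : realType) (k : nat) : set ('I_5 -> {mpoly R[5]}) :=
  [set (fun i => fps_hcomp k.+1 ((nf_map s - fps_linear (N23 R)) i))
     | s in [set: nf_series R]].

(* Main.v *)
Require Import Defs.
From mathcomp Require Import all_boot all_order all_algebra.
From mathcomp Require Import mpoly.
From mathcomp Require Import classical_sets functions reals.
From mathcomp Require Import boolp ring lra.

(** The substitution operator [T p = p(N x)] sends x1 -> x2 -> 0 and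
    x3 -> x4 -> x5 -> 0, so it maps each monomial to a monomial or to 0 and is
    injective on the monomials that it does not kill. Eliminating the unknown
    [phi] from [hom_op N phi = g] block by block shows that [g] is in the image
    iff [g2 + T g1] lies in the image of [T^2], that is, is a multiple of a power
    of x5, and [g5 + T g4 + T^2 g3 = 0] ([T^3 = 0] in positive degree). On the other
    hand the style is cut out by monomial conditions: [g1, g3, g4] are supported
    on certain monomials, and [g2, g4, g5] are prescribed nonnegative multiples of
    [T g1, T g3, T g4] on the image of [T]. Since [1 + lam], [1 + mu] and 3 are
    nonzero, the two invariants determine an element of the style, and they can
    be prescribed arbitrarily. *)

Set Implicit Arguments.
Unset Strict Implicit.
Unset Printing Implicit Defensive.
Import Order.TTheory GRing.Theory Num.Theory.
Local Open Scope ring_scope.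

(** * Coefficients of a monomial times a power series in some of the variables *)

Section Terms.
Variables (R : realType) (n : nat).
Implicit Types (a e : 'X_{1..n}).

Definition fps_mono e : fps R n := fun a => (a == e)%:R.

Lemma fps_mul_mono e (g : fps R n) a :
  fps_mul (fps_mono e) g a = if (e <= a)%MM then g (a - e)%MM else 0.
Proof.
rewrite /fps_mul /fps_mono; case: ifP => [le_ea|nle_ea]; last first.
  apply: big1 => b /eqP ab; case: eqP => [be|_]; last by rewrite mul0r.
  by have := lem_addr b.1 b.2; rewrite -ab be nle_ea.
have lt_e : (mdeg e < (mdeg a).+1)%N.
  by rewrite ltnS -(submK le_ea) mdegD leq_addl.
have lt_ae : (mdeg (a - e) < (mdeg a).+1)%N by rewrite ltnS mdegB.
rewrite (bigD1 (BMultinom lt_e, BMultinom lt_ae)) /=; last by rewrite addmC submK.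
rewrite eqxx mul1r big1 ?addr0 // => b /andP[/eqP ab /negP neq_b].
case: eqP => [be|_]; last by rewrite mul0r.
case: neq_b; apply/eqP; case: b ab be => b1 b2 /= ab be.
by congr pair; apply/val_inj => //=; rewrite -be -(addmK b1 b2) addmC -ab.
Qed.

Lemma fps_mul_mono_var e i :
  fps_mul (fps_mono e) (fps_var R i) = fps_mono (e + U_(i))%MM.
Proof.
apply/funext => a; rewrite fps_mul_mono /fps_var /fps_mono.
case: ifP => [le_ea|nle_ea].
  by rewrite -{2}(submK le_ea) addmC eqm_add2l.
by case: eqP => // ae; rewrite ae lem_addr in nle_ea.
Qed.

Lemma fps_mul_var i j :
  fps_mul (fps_var R i) (fps_var R j) = fps_mono (U_(i) + U_(j))%MM.
Proof. exact: fps_mul_mono_var. Qed.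

Variables (m : nat) (t : m.-tuple 'I_n).
Hypothesis t_uniq : uniq t.
Implicit Types (b : 'X_{1..m}).

(** On exponents, [push] is the substitution performed by [fps_at]; [pull] inverts it because [t]
    has no repetitions. *)
Definition push b : 'X_{1..n} := (\sum_(i < m) U_(tnth t i) *+ b i)%MM.
Definition pull a : 'X_{1..m} := [multinom a (tnth t i) | i < m].

Lemma push_tnth b i : push b (tnth t i) = b i.
Proof.
rewrite mnm_sumE (bigD1 i) //= mulmnE mnm1E eqxx mul1n big1 ?addn0 // => j neq_ji.
by rewrite mulmnE mnm1E (inj_eq (tuple_uniqP t t_uniq)) (negbTE neq_ji).
Qed.

Lemma push_notin b j : j \notin t -> push b j = 0%N.
Proof.
move=> tj; rewrite mnm_sumE big1 // => i _; rewrite mulmnE mnm1E.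
by case: eqP => // ij; rewrite -ij mem_tnth in tj.
Qed.

Lemma pushK : cancel push pull.
Proof. by move=> b; apply/mnmP => i; rewrite mnmE push_tnth. Qed.

Lemma pullK a : (forall j, j \notin t -> a j = 0%N) -> push (pull a) = a.
Proof.
move=> a0; apply/mnmP => j; have [/tnthP[i ->]|tj] := boolP (j \in t).
  by rewrite push_tnth mnmE.
by rewrite push_notin ?a0.
Qed.

Lemma mdeg_push b : mdeg (push b) = mdeg b.
Proof.
rewrite mdeg_sum mdegE; apply: eq_bigr => i _.
by rewrite mdegMn mdeg1 mul1n.
Qed.

Lemma fps_atE (f : fps R m) a :
  fps_at f t a = if [forall j, (j \in t) || (a j == 0%N)] then f (pull a) else 0.
Proof.
rewrite /fps_at; case: ifP => [/forallP a0|nsupp]; last first.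
  rewrite big1 // => b /eqP ab; case/negP: nsupp; apply/forallP => j.
  by case: (boolP (j \in t)) => //= tj; rewrite -ab push_notin.
have pa : push (pull a) = a.
  by apply: pullK => j tj; have := a0 j; rewrite (negbTE tj) => /eqP.
have lt_pa : (mdeg (pull a) < (mdeg a).+1)%N by rewrite -{2}pa mdeg_push.
rewrite (big_pred1 (BMultinom lt_pa)) // => b /=.
rewrite -/(push b); apply/eqP/eqP => [ab|->//]; apply/val_inj.
by rewrite /= -[LHS]pushK ab.
Qed.

(** The exponents of the monomials that can occur in x^e f(x_t). *)
Definition fits e a : bool :=
  [forall j, if j \in t then (e j <= a j)%N else a j == e j].

Lemma fps_mul_mono_at e (f : fps R m) a :
  fps_mul (fps_mono e) (fps_at f t) a = if fits e a then f (pull (a - e)%MM) else 0.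
Proof.
rewrite fps_mul_mono; case: ifP => [/mnm_lepP le_ea|nle_ea]; last first.
  case: ifP => // /forallP ea; case/mnm_lepP: nle_ea => j.
  by have := ea j; case: ifP => // _ /eqP ->.
rewrite fps_atE; congr (if _ then _ else _); apply: eq_forallb => j.
by rewrite mnmBE le_ea; case: (j \in t) => //=; rewrite subn_eq0 eqn_leq le_ea andbT.
Qed.

(** Division by x^e of the part of [g] that fits, read in the variables of [t]. *)
Definition lift_term e (g : 'X_{1..n} -> R) : fps R m := fun b => g (push b + e)%MM.

Lemma fps_mul_mono_at_lift e (g : 'X_{1..n} -> R) a :
  fps_mul (fps_mono e) (fps_at (lift_term e g) t) a = if fits e a then g a else 0.
Proof.
rewrite fps_mul_mono_at /lift_term.
case: ifP => // /forallP ea; congr g.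
have le_ea : (e <= a)%MM.
  by apply/mnm_lepP => j; have := ea j; case: ifP => // _ /eqP ->.
rewrite -[RHS](submK le_ea); congr (_ + _)%MM; apply: pullK => j tj.
by rewrite mnmBE; have := ea j; rewrite (negbTE tj) => /eqP ->; rewrite subnn.
Qed.

End Terms.

(** * Monomials in five variables and the substitution x |-> N x *)

Lemma ord5_ind (P : 'I_5 -> Prop) : P i1 -> P i2 -> P i3 -> P i4 -> P i5 -> forall i, P i.
Proof.
move=> P1 P2 P3 P4 P5 [[|[|[|[|[|//]]]]] i_lt5].
- by rewrite (bool_irrelevance i_lt5 isT).
- by rewrite (bool_irrelevance i_lt5 isT).
- by rewrite (bool_irrelevance i_lt5 isT).
- by rewrite (bool_irrelevance i_lt5 isT).
- by rewrite (bool_irrelevance i_lt5 isT).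
Qed.

Lemma forall_ord5 (P : pred 'I_5) :
  [forall i, P i] = [&& P i1, P i2, P i3, P i4 & P i5].
Proof.
apply/forallP/and5P => [Pi|[P1 P2 P3 P4 P5]]; first by split.
exact: ord5_ind.
Qed.

Lemma big_ord5 (V : Type) (idx : V) (op : Monoid.law idx) (F : 'I_5 -> V) :
  \big[op/idx]_(i < 5) F i = op (F i1) (op (F i2) (op (F i3) (op (F i4) (F i5)))).
Proof.
rewrite 5!big_ord_recl big_ord0 Monoid.mulm1.
by do 5?[congr (op _ _)]; congr F; apply/val_inj.
Qed.

Lemma vec5E (T : Type) (a1 a2 a3 a4 a5 : T) (v := vec5 a1 a2 a3 a4 a5) :
  (v i1 = a1) * (v i2 = a2) * (v i3 = a3) * (v i4 = a4) * (v i5 = a5).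
Proof. by []. Qed.

(* The substitution x := N x maps a monomial to [x^c] iff [low c], and then
   [x^(shift c)] is the only such monomial; [unshift] is the forward map. *)
Definition shift (c : 'X_{1..5}) : 'X_{1..5} :=
  [multinom vec5 (c i2) 0%N (c i4) (c i5) 0%N i | i < 5].

Definition low (c : 'X_{1..5}) : bool := (c i1 == 0%N) && (c i3 == 0%N).

(** All supports in the style depend only on which exponents vanish, so 32 cases decide every
    test. *)
Ltac case_support a :=
  case: (a i1 == 0%N); case: (a i2 == 0%N); case: (a i3 == 0%N);
  case: (a i4 == 0%N); case: (a i5 == 0%N).

Ltac eval_terms :=
  rewrite !fps_mul_mono_at // /fits !forall_ord5 !mnmE /= ?vec5E ?addn0 ?lt0n;
  repeat match goal with |- context [?f (pull ?t ?b)] =>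
    let v := fresh in set v := f (pull t b); move: v => v end.

Ltac eval_lifts :=
  rewrite /= !fps_mul_mono_at_lift // ?fps_mul_mono_at //
    /fits !forall_ord5 !mnmE /= ?vec5E ?addn0 ?lt0n.

(** * The style described by conditions on coefficients *)

Section StyleCoefficients.
Variable R : realType.
Implicit Types (a c : 'X_{1..5}).

Local Notation term e f t := (fps_mul (fps_mono R e) (fps_at f t)).
Local Notation half := (2^-1 : R).

Definition nf_tail (s : nf_series R) (i : 'I_5) : fps R 5 :=
  (nf_map s - fps_linear (N23 R)) i.

Lemma nf_tailE (s : nf_series R) a :
  [/\ nf_tail s i1 a = term U_(i1)%MM (F1_1 s) [tuple i1; i3; i4] a
        + term (U_(i3) + U_(i4))%MM (F4_1 s) [tuple i3; i4] a
        + half * term U_(i3)%MM (F3_1 s) [tuple i3] a,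
      nf_tail s i2 a = term (U_(i1) + U_(i2))%MM (F12_0 s) [tuple i1; i2; i3; i4; i5] a
        + term (U_(i1) + U_(i5))%MM (F15_0 s) [tuple i1; i3; i4; i5] a
        + term (U_(i2) + U_(i3))%MM (F23_0 s) [tuple i2; i3; i4; i5] a
        + term (U_(i3) + U_(i5))%MM (F35_0 s) [tuple i3; i4; i5] a
        + term U_(i1)%MM (F1_0 s) [tuple i1; i3; i4] a
        + term U_(i2)%MM (F1_1 s) [tuple i2; i4; i5] a
        + term (U_(i3) + U_(i4))%MM (F4_0 s) [tuple i3; i4] a
        + half * term (U_(i4) + U_(i5))%MM (F4_1 s) [tuple i4; i5] a
        + term U_(i3)%MM (F3_0 s) [tuple i3] a
        + term U_(i4)%MM (F3_1 s) [tuple i4] a,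
      nf_tail s i3 a = half * term U_(i3)%MM (G3_2 s) [tuple i3] a,
      nf_tail s i4 a = half * term U_(i1)%MM (G1_1 s) [tuple i1; i3; i4] a
        + half * term (U_(i3) + U_(i4))%MM (G4_1 s) [tuple i3; i4] a
        + half * term U_(i3)%MM (G3_1 s) [tuple i3] a
        + half * term U_(i4)%MM (G3_2 s) [tuple i4] a
    & nf_tail s i5 a = term (U_(i1) + U_(i2))%MM (G12_0 s) [tuple i1; i2; i3; i4; i5] a
        + term (U_(i1) + U_(i5))%MM (G15_0 s) [tuple i1; i3; i4; i5] a
        + term (U_(i2) + U_(i3))%MM (G23_0 s) [tuple i2; i3; i4; i5] a
        + term (U_(i3) + U_(i5))%MM (G35_0 s) [tuple i3; i4; i5] a
        + term U_(i1)%MM (G1_0 s) [tuple i1; i3; i4] a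
        + term U_(i2)%MM (G1_1 s) [tuple i2; i4; i5] a
        + term (U_(i3) + U_(i4))%MM (G4_0 s) [tuple i3; i4] a
        + half * term (U_(i4) + U_(i5))%MM (G4_1 s) [tuple i4; i5] a
        + term U_(i3)%MM (G3_0 s) [tuple i3] a
        + half * term U_(i4)%MM (G3_1 s) [tuple i4] a
        + half * term U_(i5)%MM (G3_2 s) [tuple i5] a].
Proof.
rewrite -!fps_mul_var /nf_tail /nf_map.
have cancel i (v w : 'I_5 -> fps R 5) : (v + (w - v)) i = w i by rewrite addrC subrK.
have evalD i (v w : 'I_5 -> fps R 5) : (v + w) i = v i + w i by [].
have addE (f g : fps R 5) b : (f + g) b = f b + g b by [].
have zeroE b : (0 : fps R 5) b = 0 by [].
(* Regrouping everything after the linear part lets the latter cancel as a whole. *)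
rewrite -!(addrA (fps_linear _)) !cancel !evalD !vec5E !addE !zeroE.
by split; rewrite ?(addr0, add0r).
Qed.

Section Transport.
Variables (m : nat) (t t' : m.-tuple 'I_5) (e e' : 'X_{1..5}).
Hypotheses (t_uniq : uniq t) (t'_uniq : uniq t').
Hypothesis fits_shift : forall c, low c -> fits t' e' c = fits t e (shift c).
Hypothesis pull_shift : forall c, pull t' (c - e')%MM = pull t (shift c - e)%MM.

(** When a series occurs twice, as in x1 F1_1(x1, x3, x4) and x2 F1_1(x2, x4, x5), the second
    occurrence is [T] of the first; this is the coefficientwise form. *)
Lemma term_shift (f : fps R m) c : low c -> term e' f t' c = term e f t (shift c).
Proof. by move=> low_c; rewrite !fps_mul_mono_at // fits_shift // pull_shift. Qed.
End Transport.

Lemma term_shift2 (f : fps R 3) c : low c ->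
  term U_(i2)%MM f [tuple i2; i4; i5] c
  = term U_(i1)%MM f [tuple i1; i3; i4] (shift c).
Proof.
apply: term_shift => // {}c => [/andP[/eqP c1 /eqP c3]|].
  by rewrite /fits !forall_ord5 !mnmE /= ?c1 ?c3 /= ?andbT.
by apply/mnmP; case=> -[|[|[|//]]] p; rewrite !mnmE.
Qed.

Lemma term_shift45 (f : fps R 2) c : low c ->
  term (U_(i4) + U_(i5))%MM f [tuple i4; i5] c
  = term (U_(i3) + U_(i4))%MM f [tuple i3; i4] (shift c).
Proof.
apply: term_shift => // {}c => [/andP[/eqP c1 /eqP c3]|].
  by rewrite /fits !forall_ord5 !mnmE /= ?c1 ?c3 /= ?andbT.
by apply/mnmP; case=> -[|[|//]] p; rewrite !mnmE.
Qed.

Lemma term_shift4 (f : fps R 1) c : low c ->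
  term U_(i4)%MM f [tuple i4] c = term U_(i3)%MM f [tuple i3] (shift c).
Proof.
apply: term_shift => // {}c => [/andP[/eqP c1 /eqP c3]|].
  by rewrite /fits !forall_ord5 !mnmE /= ?c1 ?c3 /= ?andbT.
by apply/mnmP; case=> -[|//] p; rewrite !mnmE.
Qed.

Lemma term_shift5 (f : fps R 1) c : low c ->
  term U_(i5)%MM f [tuple i5] c = term U_(i4)%MM f [tuple i4] (shift c).
Proof.
apply: term_shift => // {}c => [/andP[/eqP c1 /eqP c3]|].
  by rewrite /fits !forall_ord5 !mnmE /= ?c1 ?c3 /= ?andbT.
by apply/mnmP; case=> -[|//] p; rewrite !mnmE.
Qed.

(* Ratios of the paired coefficients in the expression of the normal form, such
   as 2 for [x4 F3_1 s] against [half x3 F3_1 s]. The value 0 at powers of x5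
   is harmless because [g i1] vanishes at the powers of x4. *)
Definition lam c : R :=
  if c i2 != 0%N then 1
  else if c i4 == 0%N then 0 else if c i5 == 0%N then 2 else 2^-1.

Definition mu c : R := if c i2 != 0%N then 2 else 1.

(** Rows 2 and 5 are free off the image of [T]: in each, seven terms with their own series have
    disjoint supports covering all exponents with x1 or x3. The relation between [g i4] and [g i3]
    concerns powers of x4 and x3, both governed by [G3_2]. *)
Definition style_coef a (g : 'I_5 -> 'X_{1..5} -> R) : Prop :=
  [/\ [|| a i2 != 0%N, a i5 != 0%N | (a i1 == 0%N) && (a i3 == 0%N)] -> g i1 a = 0,
      low a -> g i2 a = lam a * g i1 (shift a)
    & [/\ [|| a i1 != 0%N, a i2 != 0%N, a i4 != 0%N | a i5 != 0%N] -> g i3 a = 0,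
      [|| a i2 != 0%N | a i5 != 0%N] -> g i4 a = 0,
      [&& low a, a i2 == 0%N & a i5 == 0%N] -> g i4 a = g i3 (shift a)
    & low a -> g i5 a = mu a * g i4 (shift a)]].

Lemma support_neq0 a : a != 0%MM ->
  ~~ [&& a i1 == 0%N, a i2 == 0%N, a i3 == 0%N, a i4 == 0%N & a i5 == 0%N].
Proof.
apply: contra => /and5P[/eqP ? /eqP ? /eqP ? /eqP ? /eqP ?].
by apply/eqP/mnmP; apply: ord5_ind; rewrite mnmE.
Qed.

Lemma nf_tail_style_coef (s : nf_series R) a : style_coef a (nf_tail s).
Proof.
have [g1 g2 g3 g4 g5] := nf_tailE s a.
have [h1 _ h3 h4 _] := nf_tailE s (shift a).
split; last split.
- rewrite g1; eval_terms.
  by case_support a => //=; rewrite ?mulr0 ?addr0.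
- move=> low_a; have [c1 c3] := andP low_a.
  (* After the shifts, rows 1 and 2 read each common series at the same exponent, so [lra] sees the
     same atom. *)
  rewrite g2 h1 term_shift2 // term_shift45 // term_shift4 // /lam; eval_terms.
  by rewrite c1 c3 /=; case_support a => //=; clear; lra.
- by rewrite g3; eval_terms; case_support a => //=; rewrite ?mulr0.
- by rewrite g4; eval_terms; case_support a => //=; rewrite ?mulr0 ?addr0.
- case/and3P => low_a c2 c5; have [c1 c3] := andP low_a.
  rewrite g4 h3 term_shift4 //; eval_terms; rewrite c1 c2 c3 c5 /=.
  by case_support a => //=; clear; lra.
- move=> low_a; have [c1 c3] := andP low_a.
  rewrite g5 h4 term_shift2 // term_shift45 // term_shift4 // term_shift5 // /mu.
  eval_terms; rewrite c1 c3 /=.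
  by case_support a => //=; clear; lra.
Qed.

(** Each series is read in the first row where it occurs; [twice] undoes a factor one half found
    there. *)
Definition style_series (g : 'I_5 -> 'X_{1..5} -> R) : nf_series R :=
  let g1 := g i1 in let g2 := g i2 in let g3 := g i3 in let g4 := g i4 in let g5 := g i5 in
  let twice h := fun a : 'X_{1..5} => 2 * h a : R in
  {| F12_0 := lift_term [tuple i1; i2; i3; i4; i5] (U_(i1) + U_(i2))%MM g2;
     G12_0 := lift_term [tuple i1; i2; i3; i4; i5] (U_(i1) + U_(i2))%MM g5;
     F15_0 := lift_term [tuple i1; i3; i4; i5] (U_(i1) + U_(i5))%MM g2;
     G15_0 := lift_term [tuple i1; i3; i4; i5] (U_(i1) + U_(i5))%MM g5;
     F23_0 := lift_term [tuple i2; i3; i4; i5] (U_(i2) + U_(i3))%MM g2;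
     G23_0 := lift_term [tuple i2; i3; i4; i5] (U_(i2) + U_(i3))%MM g5;
     F35_0 := lift_term [tuple i3; i4; i5] (U_(i3) + U_(i5))%MM g2;
     G35_0 := lift_term [tuple i3; i4; i5] (U_(i3) + U_(i5))%MM g5;
     F1_0 := lift_term [tuple i1; i3; i4] U_(i1)%MM g2;
     G1_0 := lift_term [tuple i1; i3; i4] U_(i1)%MM g5;
     F1_1 := lift_term [tuple i1; i3; i4] U_(i1)%MM g1;
     G1_1 := lift_term [tuple i1; i3; i4] U_(i1)%MM (twice g4);
     F4_0 := lift_term [tuple i3; i4] (U_(i3) + U_(i4))%MM g2;
     G4_0 := lift_term [tuple i3; i4] (U_(i3) + U_(i4))%MM g5;
     F4_1 := lift_term [tuple i3; i4] (U_(i3) + U_(i4))%MM g1;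
     G4_1 := lift_term [tuple i3; i4] (U_(i3) + U_(i4))%MM (twice g4);
     F3_0 := lift_term [tuple i3] U_(i3)%MM g2;
     G3_0 := lift_term [tuple i3] U_(i3)%MM g5;
     F3_1 := lift_term [tuple i3] U_(i3)%MM (twice g1);
     G3_1 := lift_term [tuple i3] U_(i3)%MM (twice g4);
     G3_2 := lift_term [tuple i3] U_(i3)%MM (twice g3) |}.

(** Within a row, the terms read off have disjoint supports, which recovers their coefficients; the
    others follow from [style_coef]. Every term carries a variable, hence the exclusion of the
    constant monomial. *)
Lemma style_seriesK (g : 'I_5 -> 'X_{1..5} -> R) :
  (forall a, style_coef a g) ->
  forall i a, a != 0%MM -> nf_tail (style_series g) i a = g i a.
Proof.
move=> coef_g i a /support_neq0 a_bits; move: i.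
have [zero1 low2 [zero3 zero4 low4 low5]] := coef_g a.
have [g1 g2 g3 g4 g5] := nf_tailE (style_series g) a.
apply: ord5_ind.
- rewrite g1; eval_lifts; move: a_bits zero1.
  by case_support a => //= _; clear => zero1; try move/(_ isT): zero1 => zero1; lra.
- have [low_a|] := boolP (low a).
    rewrite low2 // g2 term_shift2 // term_shift45 // term_shift4 // /lam.
    have [c1 c3] := andP low_a; move: a_bits.
    eval_lifts; rewrite c1 c3 /=; case_support a => //= _; clear; lra.
  by rewrite g2 /low; eval_lifts; move: a_bits; case_support a => //= _ _; clear; lra.
- rewrite g3; eval_lifts; move: a_bits zero3.
  by case_support a => //= _; clear => zero3; try move/(_ isT): zero3 => zero3; lra.
- have [low_a|] := boolP [&& low a, a i2 == 0%N & a i5 == 0%N].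
    rewrite low4 // g4; have /and3P[low_a' c2 c5] := low_a.
    have [c1 c3] := andP low_a'; rewrite term_shift4 //; move: a_bits.
    by eval_lifts; rewrite c1 c2 c3 c5 /=; case_support a => //= _; clear; lra.
  rewrite g4 /low; eval_lifts; move: a_bits zero4.
  by case_support a => //= _; clear => zero4 _; try move/(_ isT): zero4 => zero4; lra.
- have [low_a|] := boolP (low a).
    rewrite low5 // g5 term_shift2 // term_shift45 // term_shift4 // term_shift5 // /mu.
    have [c1 c3] := andP low_a; move: a_bits.
    (* If [shift a] is low, [a] is a power of x5: row 5 then contains [G3_2], which was read in row
       3, two shifts away. *)
    have [low_sa|] := boolP (low (shift a)).
      have [_ _ [_ _ low4' _]] := coef_g (shift a).
      rewrite low4'; last by rewrite low_sa !mnmE.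
      rewrite (term_shift4 _ low_sa); have [] := andP low_sa.
      rewrite !mnmE !vec5E => a2 a4.
      by eval_lifts; rewrite a2 a4 c1 c3 /=; case_support a => //= _; clear; lra.
    rewrite /low; eval_lifts; rewrite c1 c3 /=.
    by case_support a => //= _ _; clear; lra.
  by rewrite g5 /low; eval_lifts; move: a_bits; case_support a => //= _ _; clear; lra.
Qed.
End StyleCoefficients.

(** * Degree and invertibility of the exponent maps *)

Lemma mdeg5 (a : 'X_{1..5}) : mdeg a = (a i1 + (a i2 + (a i3 + (a i4 + a i5))))%N.
Proof. by rewrite mdegE big_ord5. Qed.

Lemma mdeg_shift (c : 'X_{1..5}) : low c -> mdeg (shift c) = mdeg c.
Proof.
by case/andP=> /eqP c1 /eqP c3; rewrite !mdeg5 !mnmE !vec5E c1 c3 !add0n !addn0.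
Qed.

Definition unshift (a : 'X_{1..5}) : 'X_{1..5} :=
  [multinom vec5 0%N (a i1) 0%N (a i3) (a i4) i | i < 5].

Lemma shiftK (c : 'X_{1..5}) : low c -> unshift (shift c) = c.
Proof.
case/andP=> /eqP c1 /eqP c3; apply/mnmP.
by apply: ord5_ind; rewrite !mnmE !vec5E ?mnmE ?vec5E ?c1 ?c3.
Qed.

Lemma unshiftK (a : 'X_{1..5}) : a i2 = 0%N -> a i5 = 0%N -> shift (unshift a) = a.
Proof.
move=> a2 a5; apply/mnmP.
by apply: ord5_ind; rewrite !mnmE !vec5E ?mnmE ?vec5E ?a2 ?a5.
Qed.

Lemma low_unshift (a : 'X_{1..5}) : low (unshift a).
Proof. by rewrite /low !mnmE. Qed.

(** * The two invariants of the image *)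

Section Invariants.
Variable R : realType.
Implicit Types (a c : 'X_{1..5}) (g h : 'I_5 -> 'X_{1..5} -> R).

(** [T^2] keeps only x3, which it sends to x5, so its image lives on these exponents. *)
Definition x5_power a := [&& a i1 == 0%N, a i2 == 0%N, a i3 == 0%N & a i4 == 0%N].

(* Coefficients of [g2 + T g1] and of [g5 + T g4 + T^2 g3]. *)
Definition invF g a : R := g i2 a + (if low a then g i1 (shift a) else 0).

Definition invG g a : R :=
  g i5 a + (if low a then
    g i4 (shift a) + (if low (shift a) then g i3 (shift (shift a)) else 0) else 0).

Lemma lam_ge0 c : 0 <= lam R c.
Proof. by rewrite /lam; do 3?[case: ifP => _]; lra. Qed.

Lemma mu_ge1 c : 1 <= mu R c.
Proof. by rewrite /mu; case: ifP => _; lra. Qed.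

(** On low exponents the relations turn each invariant into a positive multiple of one coefficient
    of [g i1] or [g i4]. *)
Lemma style_coef_inv0 g :
  (forall a, style_coef a g) -> (forall a, ~~ x5_power a -> invF g a = 0) ->
  (forall a, invG g a = 0) -> forall i a, g i a = 0.
Proof.
move=> coef_g invF0 invG0.
have g1 a : g i1 a = 0.
  have [zero1 _ _] := coef_g a.
  have [/zero1//|] := boolP [|| a i2 != 0%N, a i5 != 0%N | (a i1 == 0%N) && (a i3 == 0%N)].
  rewrite !negb_or !negbK => /and3P[/eqP a2 /eqP a5 a13].
  have [_ low2 _] := coef_g (unshift a).
  (* Since [a] involves x1 or x3, [unshift a] involves x2 or x4 and is not a power of x5. *)
  have := invF0 (unshift a); rewrite /invF low2 ?low_unshift // unshiftK //.
  rewrite /x5_power !mnmE !vec5E /= => /(_ a13).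
  have := lam_ge0 (unshift a); nra.
have g4_shift c : low c -> g i4 (shift c) = 0.
  move=> low_c; have [_ _ [_ _ _ low5]] := coef_g c.
  have := invG0 c; rewrite /invG low_c low5 // => sum0; have := mu_ge1 c.
  move: sum0; have [low_sc|_] := boolP (low (shift c)); last by nra.
  (* Now [shift c] is a power of x4, where rows 3 and 4 are paired: the factor is 2 + mu. *)
  have [_ _ [_ _ low4 _]] := coef_g (shift c).
  by rewrite -low4; [nra|rewrite low_sc !mnmE].
have g4 a : g i4 a = 0.
  have [_ _ [_ zero4 _ _]] := coef_g a.
  have [/zero4//|] := boolP ((a i2 != 0%N) || (a i5 != 0%N)).
  rewrite !negb_or !negbK => /andP[/eqP a2 /eqP a5].
  by rewrite -[a]unshiftK // g4_shift // low_unshift.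
have g3 a : g i3 a = 0.
  have [_ _ [zero3 _ _ _]] := coef_g a.
  have [/zero3//|] := boolP [|| a i1 != 0%N, a i2 != 0%N, a i4 != 0%N | a i5 != 0%N].
  rewrite !negb_or !negbK => /and4P[/eqP a1 /eqP a2 /eqP a4 /eqP a5].
  have [_ _ [_ _ low4 _]] := coef_g (unshift a).
  by rewrite -[a]unshiftK // -low4 // low_unshift !mnmE !vec5E a1 a4.
apply: ord5_ind => a //.
  have [_ low2 _] := coef_g a; have [low_a|nlow_a] := boolP (low a).
    by rewrite low2 // g1 mulr0.
  have := invF0 a; rewrite /invF (negbTE nlow_a) addr0; apply.
  by apply: contra nlow_a => /and4P[a1 _ a3 _]; rewrite /low a1.
have := invG0 a; rewrite /invG g4 g3; do 2?[case: ifP => _]; rewrite ?addr0 //.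
Qed.

(* On chains x3^d -> x4^d -> x5^d the three last components all contribute to
   [invG], hence the denominator 3; elsewhere only two of them do. *)
Definition style_part h : 'I_5 -> 'X_{1..5} -> R :=
  let p := invF h in let q := invG h in
  let nu c := if x5_power c then 3 else 1 + mu R c in
  let w1 a := if [&& a i2 == 0%N, a i5 == 0%N & (a i1 != 0%N) || (a i3 != 0%N)]
              then p (unshift a) / (1 + lam R (unshift a)) else 0 in
  let w4 a := if (a i2 == 0%N) && (a i5 == 0%N)
              then q (unshift a) / nu (unshift a) else 0 in
  vec5 w1 (fun c => if low c then lam R c * w1 (shift c) else p c)
    (fun a => if [&& a i1 == 0%N, a i2 == 0%N, a i4 == 0%N & a i5 == 0%N]
              then q (unshift (unshift a)) / 3 else 0)
    w4 (fun c => if low c then mu R c * w4 (shift c) else q c).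

Lemma style_part_coef h a : style_coef a (style_part h).
Proof.
rewrite /style_part; split; rewrite ?vec5E.
- by case/or3P=> [/negbTE->|/negbTE->|/andP[-> ->]]; rewrite ?andbF.
- by move=> ->.
split.
- by case/or4P=> /negbTE->; rewrite ?andbF.
- by case/orP=> /negbTE->; rewrite ?andbF.
- case/and3P=> /[dup] low_a /andP[a1 a3] a2 a5; rewrite a2 a5 !mnmE !vec5E a2 a5 /=.
  (* At a power of x4, [unshift a] is a power of x5, so row 4 also divides by 3. *)
  by rewrite shiftK // /x5_power !mnmE !vec5E a1 a3.
- by move=> ->.
Qed.

(** Dividing by 1 + lam or 1 + mu makes the two shares add up to the prescribed value; on powers of
    x5, [invG] has three shares of one third. *)
Lemma style_part_inv h a :
  (~~ x5_power a -> invF (style_part h) a = invF h a)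
  /\ invG (style_part h) a = invG h a.
Proof.
have lamP : 1 + lam R a != 0 by rewrite lt0r_neq0 //; have := lam_ge0 a; lra.
have muP : 1 + mu R a != 0 by rewrite lt0r_neq0 //; have := mu_ge1 a; lra.
split; last first.
  rewrite {1}/invG /style_part !vec5E; case: ifP => // low_a; last by rewrite addr0.
  rewrite shiftK // !mnmE !vec5E /= /x5_power.
  (* For low [a] the test in [nu] is thus the inner test of [invG]. *)
  have -> : [&& a i1 == 0%N, a i2 == 0%N, a i3 == 0%N & a i4 == 0%N] = low (shift a).
    by have /andP[-> ->] := low_a; rewrite /low !mnmE.
  case: ifP => [low_sa|_].
    have /andP[] := low_sa; rewrite !mnmE !vec5E => a2 _.
    by rewrite !shiftK // /mu a2 /=; lra.
  by rewrite addr0 -[X in _ + X]mul1r -mulrDl addrC mulrC divfK.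
move=> n5; rewrite {1}/invF /style_part !vec5E; case: ifP => low_a; last by rewrite addr0.
rewrite !mnmE !vec5E shiftK //= -negb_and; case: ifP => [_|/negbFE/andP[a2 a4]].
  by rewrite -[X in _ + X]mul1r -mulrDl addrC mulrC divfK.
by case/andP: low_a n5 => a1 a3; rewrite /x5_power a1 a2 a3 a4.
Qed.

(** The invariants and exponent maps respect degree, so truncation loses nothing of the style part
    of a homogeneous map. *)
Lemma style_part_degree d h :
  (forall i a, mdeg a != d -> h i a = 0) ->
  forall i a, mdeg a != d -> style_part h i a = 0.
Proof.
move=> h0 i a ad.
have p0 c : mdeg c != d -> invF h c = 0.
  by move=> cd; rewrite /invF; case: ifP => ?; rewrite !h0 ?mdeg_shift ?addr0.
have q0 c : mdeg c != d -> invG h c = 0.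
  move=> cd; rewrite /invG; case: ifP => ?; last by rewrite h0 ?addr0.
  by case: ifP => ?; rewrite !h0 ?mdeg_shift ?addr0.
have us c : c i2 = 0%N -> c i5 = 0%N -> mdeg (unshift c) = mdeg c.
  by move=> c2 c5; rewrite -{2}(unshiftK c2 c5) mdeg_shift ?low_unshift.
move: i; rewrite /style_part; apply: ord5_ind; rewrite vec5E.
- by case: ifP => // /and3P[/eqP a2 /eqP a5 _]; rewrite p0 ?mul0r ?us.
- case: ifP => low_a; last exact: p0.
  by rewrite !mnmE /= shiftK // p0 // mul0r; case: ifP; rewrite mulr0.
- case: ifP => // /and4P[/eqP a1 /eqP a2 /eqP a4 /eqP a5].
  by rewrite q0 ?mul0r // us ?us // !mnmE.
- by case: ifP => // /andP[/eqP a2 /eqP a5]; rewrite q0 ?mul0r ?us.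
- case: ifP => low_a; last exact: q0.
  by rewrite !mnmE /= shiftK // q0 // mul0r mulr0.
Qed.
End Invariants.

(** * The homological operator *)

Section HomologicalOperator.
Variable R : realType.
Implicit Types (p : {mpoly R[5]}) (phi : 'I_5 -> {mpoly R[5]}).

Lemma N23_act (V : lmodType R) (v : 'I_5 -> V) i :
  \sum_j N23 R i j *: v j = vec5 (v i2) 0 (v i4) (v i5) 0 i.
Proof.
by move: i; apply: ord5_ind; rewrite big_ord5 vec5E !mxE /= !(scale0r, scale1r, addr0, add0r).
Qed.

(** The operator [T]. *)
Definition pullN p : {mpoly R[5]} :=
  p \mPo [tuple \sum_(s < 5) N23 R r s *: 'X_s | r < 5].

Lemma pullNB p q : pullN (p - q) = pullN p - pullN q.
Proof. exact: linearB. Qed.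

Lemma pullNZ (c : R) p : pullN (c *: p) = c *: pullN p.
Proof. exact: linearZ. Qed.

Lemma mcoeff_pullN p c : (pullN p)@_c = if low c then p@_(shift c) else 0.
Proof.
rewrite /pullN comp_mpolyE raddf_sum /=.
under eq_bigr => m _ do rewrite mcoeffZ.
rewrite -mulrb -(mulr_natr p@_(shift c)) [in RHS](mpolyE p) raddf_sum /= mulr_suml.
apply: eq_bigr => m _; rewrite mcoeffZ mcoeffX -mulrA; congr (_ * _).
rewrite big_ord5 !tnth_mktuple !N23_act !vec5E.
(* x2 and x5 go to 0, and 0^0 = 1: their factors test whether their exponents vanish. *)
rewrite !mpolyXn !expr0n.
rewrite /= -natrM mulnb; set X := _ * _.
have -> : X = ((m i2 == 0%N) && (m i5 == 0%N))%:R
              * 'X_[U_(i2) *+ m i1 + (U_(i4) *+ m i3 + U_(i5) *+ m i4)]%MM.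
  rewrite /X !mpolyXD -mulnb natrM; ring.
rewrite mulr_natl mcoeffMn mcoeffX -mulrnA mulnb; congr (_%:R : R); congr nat_of_bool.
apply/idP/idP => [/and3P[/eqP <- /eqP m2 /eqP m5]|/andP[/eqP -> /andP[c1 c3]]].
  rewrite /low !mnmE ?mulmnE ?mnmE /= !mul0n eqxx andbT; apply/eqP/mnmP.
  by apply: ord5_ind; rewrite !mnmE ?vec5E ?mnmE ?mulmnE ?mnmE /= ?muln0 ?mul1n ?addn0.
rewrite !mnmE !vec5E !andbT; apply/eqP/mnmP.
apply: ord5_ind; rewrite !mnmE ?mulmnE ?mnmE /= ?mul0n ?mul1n ?addn0 //.
  by rewrite (eqP c1).
by rewrite (eqP c3).
Qed.

Definition coefs phi : 'I_5 -> 'X_{1..5} -> R := fun i a => (phi i)@_a.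

Lemma hom_opE phi i :
  hom_op (N23 R) phi i = vec5 (phi i2) 0 (phi i4) (phi i5) 0 i - pullN (phi i).
Proof. by rewrite /hom_op N23_act. Qed.

Lemma pullN_homog d p : p \is d.-homog -> pullN p \is d.-homog.
Proof.
move=> hom_p; apply/dhomogP => m; rewrite mcoeff_msupp mcoeff_pullN.
case: ifP => [low_m|_]; last by rewrite eqxx.
by rewrite -mcoeff_msupp => /(dhomog_mf hom_p) /=; rewrite -(mdeg_shift low_m).
Qed.

Lemma hom_op_homog k phi :
  @hpoly_map R 5 k phi -> @hpoly_map R 5 k (hom_op (N23 R) phi).
Proof.
move=> hom_phi i; rewrite hom_opE; apply: rpredB; last exact/pullN_homog/hom_phi.
by move: i; apply: ord5_ind; rewrite vec5E ?rpred0 //; apply: hom_phi.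
Qed.

Lemma hom_op_linear c phi psi :
  hom_op (N23 R) (c *: phi + psi) = c *: hom_op (N23 R) phi + hom_op (N23 R) psi.
Proof.
apply/funext => i; rewrite hom_opE /pullN.
change (vec5 (c *: phi i2 + psi i2) 0 (c *: phi i4 + psi i4) (c *: phi i5 + psi i5) 0 i
  - pullN (c *: phi i + psi i)
  = c *: hom_op (N23 R) phi i + hom_op (N23 R) psi i).
rewrite !hom_opE /pullN linearP /= scalerBr opprD addrACA; congr (_ + _).
by move: i; apply: ord5_ind; rewrite !vec5E ?scaler0 ?addr0.
Qed.

Lemma invF_coefs phi a :
  invF (coefs phi) a = (phi i2 + pullN (phi i1))@_a.
Proof. by rewrite mcoeffD mcoeff_pullN. Qed.

Lemma invG_coefs phi a :
  invG (coefs phi) a = (phi i5 + pullN (phi i4 + pullN (phi i3)))@_a.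
Proof. by rewrite mcoeffD mcoeff_pullN mcoeffD mcoeff_pullN. Qed.

Lemma pullNX (m : 'X_{1..5}) :
  m i2 = 0%N -> m i5 = 0%N -> pullN 'X_[m] = 'X_[unshift m].
Proof.
move=> m2 m5; apply/mpolyP => c; rewrite mcoeff_pullN !mcoeffX.
case: ifP => [low_c|nlow_c].
  congr (_%:R : R); congr nat_of_bool.
  by apply/eqP/eqP => [->|<-]; [apply: shiftK|rewrite unshiftK].
by case: eqP => // mc; rewrite -mc low_unshift in nlow_c.
Qed.

Lemma mcoeff_homog d p a : p \is d.-homog -> mdeg a != d -> p@_a = 0.
Proof. exact: dhomog_nemf_coeff. Qed.

(** Telescoping leaves -T^2 phi1 and -T^3 phi3. The first lives on powers of x5; the second is at
    most a constant, hence 0 in positive degree. *)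
Lemma hom_op_inv k phi a : @hpoly_map R 5 k phi ->
  (~~ x5_power a -> invF (coefs (hom_op (N23 R) phi)) a = 0)
  /\ invG (coefs (hom_op (N23 R) phi)) a = 0.
Proof.
move=> hom_phi; rewrite invF_coefs invG_coefs !hom_opE !vec5E !sub0r.
rewrite pullNB addKr (pullNB (phi i4)) subrKA pullNB addKr.
rewrite !mcoeffN !mcoeff_pullN; split=> [n5|].
  case: ifP => low_a; last by rewrite oppr0.
  case: ifP => [low_sa|]; last by rewrite oppr0.
  case/negP: n5; have /andP[a1 a3] := low_a; have := low_sa.
  by rewrite /low !mnmE !vec5E /x5_power a1 a3 => /andP[-> ->].
case: ifP => low_a; last by rewrite oppr0.
case: ifP => low_sa; last by rewrite oppr0.
case: ifP => low_ssa; last by rewrite oppr0.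
rewrite (_ : shift _ = 0%MM).
  by rewrite (mcoeff_homog (hom_phi i3)) ?oppr0 ?mdeg0.
have /andP[a1 a3] := low_a.
move: low_sa low_ssa; rewrite /low !mnmE !vec5E ?mnmE ?vec5E.
move=> /andP[/eqP a2 /eqP a4] /andP[_ /eqP a5].
by apply/mnmP; apply: ord5_ind; rewrite !mnmE ?vec5E ?mnmE ?vec5E ?mnmE ?vec5E ?a2 ?a4 ?a5.
Qed.

(** Rows 1, 3 and 4 give phi2 = g1 + T phi1, phi4 = g3 + T phi3 and phi5 = g4 + T phi4; rows 2 and 5
    then become conditions on the invariants. *)
Lemma inv0_hom_op k g : @hpoly_map R 5 k g ->
  (forall a, ~~ x5_power a -> invF (coefs g) a = 0) ->
  (forall a, invG (coefs g) a = 0) ->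
  exists2 phi, @hpoly_map R 5 k phi & hom_op (N23 R) phi = g.
Proof.
move=> hom_g g_F g_G.
pose x3k : {mpoly R[5]} := 'X_[U_(i3) *+ k.+1].
pose x5k : {mpoly R[5]} := 'X_[U_(i5) *+ k.+1].
have hom_x3k : x3k \is k.+1.-homog by rewrite dhomogX /= mdegMn mdeg1 mul1n.
have pull2_x3k : pullN (pullN x3k) = x5k.
  rewrite /x3k !pullNX ?mulmnE ?mnmE ?vec5E ?mulmnE ?mnmE //; congr 'X_[_].
  by apply/mnmP; apply: ord5_ind; rewrite !mnmE !vec5E ?mnmE ?vec5E !mulmnE ?mnmE.
pose c := (g i2 + pullN (g i1))@_(U_(i5) *+ k.+1).
(* By homogeneity, vanishing off powers of x5 leaves a single monomial. *)
have g2E : g i2 + pullN (g i1) = c *: x5k.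
  apply/mpolyP => a; rewrite -invF_coefs mcoeffZ mcoeffX.
  case: eqP => [<-|neq_a]; first by rewrite mulr1 invF_coefs.
  rewrite mulr0; have [/and4P[/eqP a1 /eqP a2 /eqP a3 /eqP a4]|/g_F//] := boolP (x5_power a).
  have hom_F : g i2 + pullN (g i1) \is k.+1.-homog.
    by apply: rpredD; [|apply: pullN_homog]; apply: hom_g.
  rewrite invF_coefs (mcoeff_homog hom_F) // mdeg5 a1 a2 a3 a4; apply/eqP => a5.
  case: neq_a; apply/mnmP.
  by apply: ord5_ind; rewrite mulmnE mnmE ?a1 ?a2 ?a3 ?a4 ?mul1n //= -a5.
have g5E : g i5 + pullN (g i4 + pullN (g i3)) = 0.
  by apply/mpolyP => a; rewrite -invG_coefs g_G mcoeff0.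
(* The first entry absorbs c x5^(k+1), because T^2 x3^(k+1) = x5^(k+1). *)
exists (vec5 (- c *: x3k) (g i1 - c *: pullN x3k) 0 (g i3) (g i4 + pullN (g i3))).
  apply: ord5_ind; rewrite vec5E ?rpredD ?rpredN ?rpredZ ?pullN_homog ?rpred0 //;
  exact: hom_g.
apply/funext; apply: ord5_ind; rewrite hom_opE !vec5E.
- by rewrite pullNZ scaleNr opprK subrK.
- rewrite sub0r pullNB pullNZ pull2_x3k -g2E opprB.
  by rewrite addrK.
- by rewrite /pullN linear0 subr0.
- by rewrite addrK.
- by rewrite sub0r; apply/eqP; rewrite eq_sym -addr_eq0 g5E.
Qed.

Lemma mcoeff_fps_hcomp d (f : fps R 5) a :
  (fps_hcomp d f)@_a = if mdeg a == d then f a else 0.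
Proof.
rewrite raddf_sum /=; under eq_bigr => b _ do rewrite mcoeffZ mcoeffX.
case: eqP => [ad|nad]; last first.
  by apply: big1 => b /eqP bd; case: eqP => [ba|_]; [case: nad; rewrite -ba bd|rewrite mulr0].
have lt_a : (mdeg a < d.+1)%N by rewrite ad.
rewrite (bigD1 (BMultinom lt_a)) /=; last by rewrite ad.
rewrite eqxx mulr1 big1 ?addr0 // => b /andP[_ neq_b].
case: eqP => [ba|_]; last by rewrite mulr0.
by case/eqP: neq_b; apply/val_inj.
Qed.

Lemma fps_hcomp_homog d (f : fps R 5) : fps_hcomp d f \is d.-homog.
Proof.
apply/dhomogP => a; rewrite mcoeff_msupp mcoeff_fps_hcomp.
by case: (mdeg a =P d) => // _; rewrite eqxx.
Qed.

(** Each relation links exponents of equal degree. *)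
Lemma style_coef_truncate d g a : style_coef a g ->
  style_coef a (fun i b => if mdeg b == d then g i b else 0 : R).
Proof.
case=> z1 l2 [z3 z4 l4 l5]; split; last split.
- by move/z1->; rewrite if_same.
- by move=> low_a; rewrite mdeg_shift // l2 //; case: ifP; rewrite ?mulr0.
- by move/z3->; rewrite if_same.
- by move/z4->; rewrite if_same.
- by move=> /[dup] /and3P[low_a _ _] /l4 ->; rewrite mdeg_shift.
- by move=> low_a; rewrite mdeg_shift // l5 //; case: ifP; rewrite ?mulr0.
Qed.

Lemma style_coef0 a : style_coef a (fun _ _ => 0 : R).
Proof. by split; [|rewrite mulr0|split=> //; rewrite mulr0]. Qed.

Lemma style_coef_linear (x : R) g h a : style_coef a g -> style_coef a h ->
  style_coef a (fun i b => x * g i b + h i b).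
Proof.
case=> z1 l2 [z3 z4 l4 l5] [z1' l2' [z3' z4' l4' l5']]; split; last split.
- by move=> /[dup] /z1 -> /z1' ->; rewrite mulr0 addr0.
- by move=> /[dup] /l2 -> /l2' ->; rewrite mulrDr mulrCA.
- by move=> /[dup] /z3 -> /z3' ->; rewrite mulr0 addr0.
- by move=> /[dup] /z4 -> /z4' ->; rewrite mulr0 addr0.
- by move=> /[dup] /l4 -> /l4' ->.
- by move=> /[dup] /l5 -> /l5' ->; rewrite mulrDr mulrCA.
Qed.

Lemma nf_styleP k g : @nf_style R k g <->
  @hpoly_map R 5 k g /\ forall a, style_coef a (coefs g).
Proof.
split=> [[s _ <-]|[hom_g coef_g]].
  split=> [i|a]; first exact: fps_hcomp_homog.
  have -> : coefs (fun i => fps_hcomp k.+1 ((nf_map s - fps_linear (N23 R)) i))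
      = fun i b => if mdeg b == k.+1 then nf_tail s i b else 0.
    by apply/funext => i; apply/funext => b; rewrite /coefs mcoeff_fps_hcomp.
  exact/style_coef_truncate/nf_tail_style_coef.
exists (style_series (coefs g)) => //; apply/funext => i; apply/mpolyP => a.
(* Degree k + 1 is positive, which rules out the constant monomial. *)
rewrite mcoeff_fps_hcomp; case: eqP => [ad|/eqP ad].
  by apply: style_seriesK => //; rewrite -mdeg_eq0 ad.
by rewrite (mcoeff_homog (hom_g i)).
Qed.
End HomologicalOperator.

(** * The direct sum decomposition *)

Local Open Scope classical_set_scope.

Theorem theorem6p2 (R : realType) (k : nat) (hk : (1 <= k)%N) :
  direct_sum (@hpoly_map R 5 k)
             [set hom_op (N23 R) phi | phi in @hpoly_map R 5 k]
             (@nf_style R k).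
Proof.
have homB (u v : 'I_5 -> {mpoly R[5]}) : hpoly_map k u -> hpoly_map k v -> hpoly_map k (u - v).
  by move=> hu hv i; apply: rpredB; [apply: hu|apply: hv].
have hom_lin (c : R) (u v : 'I_5 -> {mpoly R[5]}) :
    hpoly_map k u -> hpoly_map k v -> hpoly_map k (c *: u + v).
  by move=> hu hv i; apply: rpredD; [apply/rpredZ/hu|apply: hv].
have hom0 : hpoly_map k (0 : 'I_5 -> {mpoly R[5]}) by move=> i; apply: rpred0.
have im0 : [set hom_op (N23 R) phi | phi in @hpoly_map R 5 k] 0.
  exists 0 => //; have := hom_op_linear (-1) (0 : 'I_5 -> {mpoly R[5]}) 0.
  by rewrite scaleN1r addNr scaleN1r addNr.
have style0 : nf_style k (0 : 'I_5 -> {mpoly R[5]}).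
  apply/nf_styleP; split=> // a.
  rewrite (_ : coefs _ = fun _ _ => 0); first exact: style_coef0.
  by apply/funext => i; apply/funext => b; rewrite /coefs mcoeff0.
split.
- split; first exact/mem_set.
  move=> c u v /set_mem[phi hom_phi <-] /set_mem[psi hom_psi <-]; apply/mem_set.
  by exists (c *: phi + psi); [exact: hom_lin|exact: hom_op_linear].
- split; first exact/mem_set.
  move=> c u v /set_mem/nf_styleP[hom_u coef_u] /set_mem/nf_styleP[hom_v coef_v].
  apply/mem_set/nf_styleP; split=> [|a]; first exact: hom_lin.
  rewrite (_ : coefs _ = fun i b => c * coefs u i b + coefs v i b).
    exact: style_coef_linear.
  by apply/funext => i; apply/funext => b; rewrite /coefs mcoeffD mcoeffZ.
- apply/seteqP; split=> [_ [_ [phi hom_phi <-] [w /nf_styleP[hom_w _] <-]]|h hom_h].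
    rewrite -[hom_op _ _]scale1r; apply: hom_lin => //; exact: hom_op_homog.
  (* [w] shares the invariants of [h], except possibly [invF] at powers of x5, so [h - w] lies in
     the image. *)
  pose w i : {mpoly R[5]} := fps_hcomp k.+1 (style_part (coefs h) i).
  have hom_w : hpoly_map k w by move=> i; apply: fps_hcomp_homog.
  have wE : coefs w = style_part (coefs h).
    apply/funext => i; apply/funext => a; rewrite /coefs mcoeff_fps_hcomp.
    case: ifP => // /negbT ad; rewrite (@style_part_degree _ k.+1) // => j b bd.
    by rewrite /coefs (mcoeff_homog (hom_h j)).
  have invB a : invF (coefs (h - w)) a = invF (coefs h) a - invF (coefs w) a
    /\ invG (coefs (h - w)) a = invG (coefs h) a - invG (coefs w) a.
    rewrite /invF /invG /coefs !mcoeffB.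
    do 2?[case: ifP => _]; rewrite ?mcoeffB; split; ring.
  have [|||phi hom_phi phiE] := @inv0_hom_op R k (h - w).
  - exact: homB.
  - move=> a n5; have [-> _] := invB a; rewrite wE.
    by have [-> // _] := style_part_inv (coefs h) a; rewrite subrr.
  - move=> a; have [_ ->] := invB a; rewrite wE.
    by have [_ ->] := style_part_inv (coefs h) a; rewrite subrr.
  exists (h - w); first by exists phi.
  exists w; last by rewrite subrK.
  by apply/nf_styleP; split=> // a; rewrite wE; apply: style_part_coef.
apply/seteqP; split=> [g [[phi hom_phi <-] /nf_styleP[_ coef_g]]|_ ->]; last by split.
apply/funext => i; apply/mpolyP => a; rewrite mcoeff0.
(* Being in the image supplies the vanishing invariants that force a style element to be 0. *)
apply: (style_coef_inv0 coef_g) => [b n5|b]; have [] := hom_op_inv b hom_phi; auto.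
Qed.
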